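(* Let $X$ and $Y$ be metric spaces, where $Y$ has no isolated points, and let $f : X \to Y$ be a continuous surjective map. If $f$ is stable, then $f$ is $H$-covering.
   Context: All spaces are metric; all maps are continuous and onto; $Y$ has no isolated points. $N^{+}$ denotes the set of positive integers. **Stable maps.** A map $f : X \to Y$ is called stable if to each point $y \in Y$ one can assign a nonempty family $\eta_y$ of subsets of $X$ such that every $U \in \eta_y$ satisfies $U \cap f^{-1}(y) \neq \emptyset$, and the following holds: for every $y\in Y$, every $U \in \eta_y$ and every open set $V \subset X$ with $V \supset U \cap f^{-1}(y)$, there exists a neighborhood $O(y)$ of $y$ in $Y$ such that $V \in \eta_w$ for every $w \in O(y)$. **Canonical compacta.** For $y \in Y$ and a countable ordinal $\alpha$ with $1 \le \alpha < \omega_1$, the canonical compacta $S_\alpha(y) \subset Y$, and the associated sub-compacta $S_\alpha^{*}(y) \subset S_\alpha(y)$, are defined by transfinite recursion. A canonical compact is understood together with the choices used to construct it; all choices of the kind described are permitted. In each case one chooses a sequence $D_y = \{y_i : i \in N^{+}\}$ of pairwise distinct points of $Y$ converging to $y$, and pairwise disjoint neighborhoods $O(y_i)$ of the points $y_i$ with $\operatorname{diam}(O(y_i)) < 1/i$ and $y \notin O(y_i)$. An infinite subsequence of $D_y$ is written $D_y^{*} = \{y_{i_k} : k \in N^{+}\}$ with $i_1 < i_2 < \cdots$. - Rank $1$: $S_1(y) = \{y\} \cup D_y$, and $S_1^{*}(y) = \{y\} \cup D_y^{*}$ for any infinite subsequence $D_y^{*}$ of $D_y$. - Successor step $\alpha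 = \beta + 1$ (with $\beta \ge 1$): for each $i$ choose a canonical compact $S_\beta(y_i) \subset O(y_i)$ and put $S_{\beta+1}(y) = \{y\} \cup \bigcup_{i} S_\beta(y_i)$. A set $S_{\beta+1}^{*}(y)$ is any set of the form $\{y\} \cup \bigcup_{k} S_\beta^{*}(y_{i_k})$, where $D_y^{*}=\{y_{i_k}\}$ is an infinite subsequence of $D_y$ and each $S_\beta^{*}(y_{i_k}) \subset S_\beta(y_{i_k})$ is an associated sub-compact of the chosen $S_\beta(y_{i_k})$. - Limit step ($\alpha$ a limit ordinal): let $\{\beta_i\}_{i \in N^{+}}$ be an increasing sequence of ordinals with $1 \le \beta_i < \alpha$; for each $i$ choose a canonical compact $S_{\beta_i}(y_i) \subset O(y_i)$ and put $S_\alpha(y) = \{y\} \cup \bigcup_{i} S_{\beta_i}(y_i)$. A set $S_\alpha^{*}(y)$ is any set of the form $\{y\} \cup \bigcup_{k} S_{\beta_{i_k}}^{*}(y_{i_k})$, where $\{y_{i_k}\}$ is an infinite subsequence of $D_y$ and each $S_{\beta_{i_k}}^{*}(y_{i_k})\subset S_{\beta_{i_k}}(y_{i_k})$ is an associated sub-compact of the chosen $S_{\beta_{i_k}}(y_{i_k})$. **$H$-covering maps.** A map $f : X \to Y$ is $H_\alpha$-covering if for every $y\in Y$ and every canonical compact $S_\alpha(y)$ there exist an associated $S_\alpha^{*}(y)$ and a set $K \subset X$ such that the restriction $f|_K : K \to S_\alpha^{*}(y)$ is a homeomorphism. A map is $H$-covering if it is $H_\alpha$-covering for every $\alpha$ with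 $1 \le \alpha < \omega_1$. *)

(* Defs.v *)
From HB Require Import structures.
From mathcomp Require Import all_boot all_order all_algebra.
From mathcomp Require Import wochoice all_classical all_reals all_analysis.
Set Implicit Arguments.
Unset Strict Implicit.
Unset Printing Implicit Defensive.
Import Order.TTheory GRing.Theory Num.Theory.
Local Open Scope classical_set_scope.
Local Open Scope ring_scope.

(* The countable ordinals: fix a well-order of the uncountable type [set nat]
   and keep the elements having countably many predecessors.  The order type of
   what remains is the first uncountable ordinal; the lemmas down to
   [omega1_uncountable] characterize it. *)

Definition wo_nat : rel (set nat) := sval (well_ordering_principle (set nat)).

Definition omega1 : Type :=
  {a : set nat | `[< countable [set b | wo_nat b a] >]}.

HB.instance Definition _ := Choice.on omega1.

Lemma wo_natP : well_order wo_nat.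
Proof. exact: (svalP (well_ordering_principle (set nat))). Qed.

Lemma wo_nat_chain : wo_chain wo_nat predT.
Proof. by move=> A _; apply: wo_natP. Qed.

Definition le_omega1 (a b : omega1) : bool := wo_nat (\val a) (\val b).

Lemma wo_nat_min (A : set (set nat)) :
  A !=set0 -> exists2 m, A m & forall a, A a -> wo_nat m a.
Proof.
case=> a Aa; pose P := [pred x | `[< A x >]].
have /wo_natP[m [[mA mle] _]] : wochoice.nonempty P by exists a; apply/asboolP.
exists m; first exact/asboolP.
by move=> b Ab; apply: mle; apply/asboolP.
Qed.

Lemma wo_nat_total : total wo_nat.
Proof. by move=> a b; apply: (wo_chainW wo_nat_chain). Qed.

Lemma wo_nat_anti : antisymmetric wo_nat.
Proof.
by move=> a b; apply: (wo_chain_antisymmetric wo_nat_chain).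
Qed.

Lemma wo_nat_trans : transitive wo_nat.
Proof.
move=> b a c ab bc.
have [|m] := @wo_nat_min [set x | x \in [:: a; b; c]].
  by exists a; rewrite /= !inE eqxx.
move=> /= mabc mle.
have [ma mb mc] : [/\ wo_nat m a, wo_nat m b & wo_nat m c].
  by split; apply: mle; rewrite /= !inE eqxx ?orbT.
move: mabc; rewrite !inE => /or3P[] /eqP e; rewrite ?e in ma mb mc * => //.
  by rewrite (@wo_nat_anti a b) // ab ma.
by rewrite -(@wo_nat_anti b c) // bc mb.
Qed.

Fact omega1_display : Order.disp_t. Proof. exact: Order.Disp tt tt. Qed.

Lemma le_omega1_refl : reflexive le_omega1.
Proof. by move=> a; have := wo_nat_total (\val a) (\val a); rewrite orbb. Qed.

Lemma le_omega1_anti : antisymmetric le_omega1.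
Proof. by move=> a b /wo_nat_anti /val_inj. Qed.

Lemma le_omega1_trans : transitive le_omega1.
Proof. by move=> b a c; apply: wo_nat_trans. Qed.

HB.instance Definition _ := Order.Le_isPOrder.Build omega1_display omega1
  le_omega1_refl le_omega1_anti le_omega1_trans.

Lemma le_omega1_total : total (<=%O : rel omega1).
Proof. by move=> a b; apply: wo_nat_total. Qed.

HB.instance Definition _ :=
  Order.POrder_isTotal.Build omega1_display omega1 le_omega1_total.

Lemma omega1_min (A : set omega1) :
  A !=set0 -> exists2 m, A m & forall a, A a -> (m <= a)%O.
Proof.
case=> a Aa; have [|_ [m Am <-] mle] := @wo_nat_min [set \val a | a in A].
  by exists (\val a); exists a.
by exists m => // b Ab; apply: mle; exists b.
Qed.

Lemma omega1_countable_lt (a : omega1) : countable [set b | (b < a)%O].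
Proof.
rewrite -(eq_countable (@inj_card_eq _ _ _ \val _)); last first.
  by move=> x y _ _ /val_inj.
apply: sub_countable (asboolW (valP a)).
by apply: subset_card_le => _ [b /ltW ba <-].
Qed.

Lemma omega1_uncountable : ~ countable [set: omega1].
Proof.
move=> cT; pose C := [set \val a | a in [set: omega1]].
have cC : countable C by apply: sub_countable cT; apply: card_image_le.
have [|m Cm mle] := @wo_nat_min (~` C).
  apply: contrapT => /nonemptyPn C0.
  have CT : C = setT by rewrite -(setCK C) C0 setC0.
  move: cC; rewrite CT => /countable_injP[g /in2TT ginj].
  pose d := [set n | exists2 A, g A = n & ~ A n].
  have [dd|nd] := pselect (d (g d)); last by apply: (nd); exists d.
  by case: (dd) => A /ginj ->.
apply: Cm; have cm : countable [set b | wo_nat b m].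
  apply: (@sub_countable _ _ _ (C `|` [set m])); last first.
    by rewrite -bigcup2E; apply: bigcup_countable => // -[|[|i]] _ /=.
  apply: subset_card_le => b /= bm.
  have [Cb|/mle mb] := pselect (C b); [by left | right].
  by apply: wo_nat_anti; rewrite bm mb.
by exists (exist _ m (asboolT cm)).
Qed.

Definition is_zero (z : omega1) : Prop := forall a, (z <= a)%O.

Definition is_succ (b a : omega1) : Prop :=
  (b < a)%O /\ forall c, ~ (b < c < a)%O.

Definition is_one (a : omega1) : Prop := exists2 z, is_zero z & is_succ z a.

Definition is_limit (a : omega1) : Prop :=
  ~ is_zero a /\ forall b, ~ is_succ b a.

Definition stable (X Y : topologicalType) (f : X -> Y) : Prop :=
  exists eta : Y -> set (set X),
    [/\ forall y, eta y !=set0,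
        forall y U, eta y U -> U `&` f @^-1` [set y] !=set0 &
        forall y U V, eta y U -> open V -> U `&` f @^-1` [set y] `<=` V ->
          \forall w \near y, eta w V].

Definition diam (R : realType) (Y : metricType R) (A : set Y) : \bar R :=
  ereal_sup [set (mdist p.1 p.2)%:E | p in A `*` A].

(* Indices start at 0, so the i-th point below is the (i+1)-st of a sequence
   indexed by the positive integers. *)
Definition spread (R : realType) (Y : metricType R)
    (y : Y) (D : nat -> Y) (O : nat -> set Y) : Prop :=
  [/\ injective D, D @ \oo --> y & trivIset [set: nat] O] /\
  forall i, [/\ nbhs (D i) (O i), (diam (O i) < (i.+1%:R^-1)%:E)%E & ~ O i y].

(* [canonical_compact a y S] is the type of constructions of [S] as a canonical
   compact of rank [a] at [y], with all the choices made.  It lives in [Type]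
   because the associated sub-compacta depend on these choices. *)
Inductive canonical_compact (R : realType) (Y : metricType R) :
    omega1 -> Y -> set Y -> Type :=
| Canonical1 a y D O of is_one a & spread y D O :
    canonical_compact a y (y |` range D)
| CanonicalS b a y D O (S : nat -> set Y) of
    ~ is_zero b & is_succ b a & spread y D O &
    (forall i, S i `<=` O i) & (forall i, canonical_compact b (D i) (S i)) :
    canonical_compact a y (y |` \bigcup_i S i)
| CanonicalL (b : nat -> omega1) a y D O (S : nat -> set Y) of
    is_limit a & {homo b : i j / (i < j)%N >-> (i < j)%O} &
    (forall i, ~ is_zero (b i) /\ (b i < a)%O) & spread y D O &
    (forall i, S i `<=` O i) & (forall i, canonical_compact (b i) (D i) (S i)) :
    canonical_compact a y (y |` \bigcup_i S i).

Fixpoint associated (R : realType) (Y : metricType R) (a : omega1) (y : Y)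
    (S : set Y) (c : canonical_compact a y S) (T : set Y) : Prop :=
  match c with
  | Canonical1 _ y D _ _ _ =>
      exists2 n : nat -> nat, {homo n : i j / (i < j)%N} &
        T = y |` range (D \o n)
  | CanonicalS _ _ y _ _ _ _ _ _ _ c' =>
      exists (n : nat -> nat) (T' : nat -> set Y),
        [/\ {homo n : i j / (i < j)%N},
            forall k, associated (c' (n k)) (T' k) &
            T = y |` \bigcup_k T' k]
  | CanonicalL _ _ y _ _ _ _ _ _ _ _ c' =>
      exists (n : nat -> nat) (T' : nat -> set Y),
        [/\ {homo n : i j / (i < j)%N},
            forall k, associated (c' (n k)) (T' k) &
            T = y |` \bigcup_k T' k]
  end.

Definition restricts_to_homeo (X Y : topologicalType) (f : X -> Y)
    (K : set X) (T : set Y) : Prop :=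
  [/\ set_bij K T f, {within K, continuous f} &
      exists g : Y -> X, {in K, cancel f g} /\ {within T, continuous g}].

Definition H_covering_at (R : realType) (X : topologicalType)
    (Y : metricType R) (f : X -> Y) (a : omega1) : Prop :=
  forall (y : Y) (S : set Y) (c : canonical_compact a y S),
    exists2 T, associated c T & exists K : set X, restricts_to_homeo f K T.

Definition H_covering (R : realType) (X : topologicalType)
    (Y : metricType R) (f : X -> Y) : Prop :=
  forall a : omega1, ~ is_zero a -> H_covering_at f a.

(* Main.v *)
Require Import Defs.
From mathcomp Require Import all_boot all_order all_algebra.
From mathcomp Require Import all_classical all_reals all_analysis.
Local Open Scope classical_set_scope.
Set Implicit Arguments.
Unset Strict Implicit.
Unset Printing Implicit Defensive.
Import Order.TTheory GRing.Theory Num.Theory.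

(** Fix a family [eta] witnessing that [f] is stable.  The statement that is
proved by induction on the construction of a canonical compact [S] at [y] is
that [S] is liftable: every open [V] in [eta y] contains the image of a
continuous section of [f] over some associated sub-compact.  As [setT] belongs
to every [eta y], and as the image of a section is mapped homeomorphically by
[f], liftability gives the theorem.  Working with all open members of [eta y],
not only [setT], is what makes the induction go through.

The induction step concerns pieces [S i] at points [D i] that converge to [y].
One looks for a point [x] of [V] above [y] such that each neighborhood of [x]
contains sections over sub-compacta of [S i] for infinitely many [i].  Given
such an [x], sections over sub-compacta of a subsequence of the pieces, taken in
smaller and smaller neighborhoods of [x], glue together with [y |-> x]
([lift_glue]); they stay continuous because each piece is relatively open in the
union and only the point [y] is a limit of different pieces.

Such an [x] exists by contradiction ([exists_good_point]).  Otherwise each point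
of [V] above [y] has an open neighborhood that contains no section over a
sub-compact of [S i] for large [i]; removing the closed sets [f @^-1` S i] for
the remaining finitely many [i], it contains none for any [i].  Let [W] be the
union of all open sets of this bad kind.  Stability puts [W] in [eta (D i)] for
large [i], so the induction hypothesis lifts a sub-compact of [S i] into [W].
The lift of the center [D i] lies in a single bad open set, and by continuity a
smaller sub-compact, concentrated near [D i], lifts into that set: a
contradiction.

The three cases of the construction become one when a point is regarded as a
compact of rank zero, its only sub-compact being itself; a compact of rank one
is then also a union of pieces ([canonical_compact_fan_ind]). *)

(** * Fans: closed pieces shrinking to a point *)

Definition fan {Y : topologicalType} (y : Y) (S : nat -> set Y) : Prop :=
  [/\ forall i, closed (S i), forall i, ~ S i y, trivIset setT S &
      forall N, nbhs y N -> \forall i \near \oo, S i `<=` N].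

(** The sub-compacta of a fan whose [i]-th piece has the sub-compacta [A i]. *)
Definition subfan {Y : Type} (y : Y) (A : nat -> set Y -> Prop) (T : set Y) :
    Prop :=
  exists (n : nat -> nat) (T' : nat -> set Y),
    [/\ {homo n : i j / (i < j)%N}, forall k, A (n k) (T' k) &
        T = y |` \bigcup_k T' k].

Lemma leq_homo_ltn (n : nat -> nat) :
  {homo n : i j / (i < j)%N} -> forall k, (k <= n k)%N.
Proof.
by move=> nh; elim=> // k IH; apply: (leq_ltn_trans IH); apply: nh.
Qed.

(** Away from [y] the pieces form a locally finite family of closed sets.  The
index set [I] is arbitrary so as to cover the union of all pieces but one. *)
Lemma closed_fan {Y : topologicalType} (y : Y) (S : nat -> set Y)
    (I : set nat) : hausdorff_space Y -> fan y S ->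
  closed (y |` \bigcup_(i in I) S i).
Proof.
move=> hY [cS _ _ Sy] z clz.
have [->|zy] := pselect (z = y); first by left.
move: zy; apply: contra_notP => nz.
apply: hY => M N zM yN.
have [m _ mN] := Sy _ yN.
pose F := \bigcup_(i in I `&` `I_m) S i.
have cF : closed F.
  apply: closed_bigcup => [|i _]; last exact: cS.
  by apply: finite_setIr; apply: finite_II.
have nFz : ~ F z by move=> [i [Ii _] Siz]; apply: nz; right; exists i.
have zF : nbhs z (~` F) by apply: open_nbhs_nbhs; split=> //; apply: closed_openC.
have [w [wT [Mw nFw]]] := clz _ (filterI zM zF).
exists w; split=> //; case: wT => [->|[i Ii Siw]]; first exact: nbhs_singleton.
have [im|mi] := ltnP i m; first by exfalso; apply: nFw; exists i.
exact: (mN i).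
Qed.

Lemma fan_comp {Y : topologicalType} (y : Y) (S : nat -> set Y) (n : nat -> nat) :
  {homo n : i j / (i < j)%N} -> fan y S -> fan y (S \o n).
Proof.
move=> nh [cS nS tS Sy]; split=> [i|i||N /Sy[m _ mN]] /=.
- exact: cS.
- exact: nS.
- move=> i j _ _ /(tS _ _ I I) nij.
  by case: (ltngtP i j) => // /nh; rewrite nij ltnn.
- exists m => // i mi; apply: mN => /=; exact: leq_trans mi (leq_homo_ltn nh i).
Qed.

(** The neighborhoods of a spread have diameters tending to zero around a sequence
that tends to [y], so they are eventually inside any neighborhood of [y]. *)
Lemma spread_fan {R : realType} {Y : metricType R} (y : Y) D O (S : nat -> set Y) :
  spread y D O -> (forall i, S i `<=` O i) -> (forall i, closed (S i)) ->
  fan y S.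
Proof.
move=> [[_ Dy tO] DO] SO cS; split=> //.
- by move=> i /SO; have [] := DO i.
- by move=> i j _ _ [z [/SO zi /SO zj]]; apply: (tO i j) => //; exists z.
move=> N /nbhs_ballP[e /= e0 eN].
have e20 : (0 < e / 2)%R by rewrite divr_gt0.
have D_e : \forall i \near \oo, ball y (e / 2)%R (D i).
  exact: Dy _ (nbhsx_ballx y _ e20).
have n_e : \forall i \near \oo, (i.+1%:R^-1 < e / 2)%R :=
  near_infty_natSinv_lt (PosNum e20).
apply: filterS (filterI D_e n_e) => i [+ ie].
rewrite ballEmdist /= => Die.
apply: (subset_trans (SO i)) => z Oiz; apply: eN.
have [Di Oe _] := DO i.
rewrite ballEmdist /= (splitr e).
apply: (le_lt_trans (metric_triangle y (D i) z)); apply: ltrD; first exact: Die.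
apply: (le_lt_trans _ ie).
rewrite -lee_fin; apply: le_trans (ltW Oe).
by apply: ereal_sup_ubound; exists (D i, z) => //; split=> //=; apply: nbhs_singleton.
Qed.

(** * Gluing sections *)

Definition lift {X Y : topologicalType} (f : X -> Y) (T : set Y) (V : set X)
    (g : Y -> X) : Prop :=
  {within T, continuous g} /\ forall z, T z -> f (g z) = z /\ V (g z).

Lemma within_continuousP {T U : topologicalType} (A : set T) (h : T -> U) :
  {within A, continuous h} <->
  forall z N, A z -> nbhs (h z) N -> \forall w \near z, A w -> N (h w).
Proof.
split=> [/subspace_continuousP hc z N Az zN|hc]; first exact: hc Az _ zN.
by apply/subspace_continuousP => z Az N; apply: hc.
Qed.

(** At [y] the glued section is continuous since the images [B k] shrink to [x],
and at a point of [T k] since the other pieces together with [y] form a closed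
set that misses this point. *)
Lemma lift_glue {X Y : topologicalType} (f : X -> Y) (y : Y)
    (S T : nat -> set Y) (V : set X) (B : nat -> set X) (x : X)
    (g : nat -> Y -> X) :
  hausdorff_space Y -> fan y S -> (forall k, T k `<=` S k) ->
  f x = y -> V x -> (forall N, nbhs x N -> \forall k \near \oo, B k `<=` N) ->
  (forall k, lift f (T k) (V `&` B k) (g k)) ->
  exists h, lift f (y |` \bigcup_k T k) V h.
Proof.
move=> hY fS TS fx Vx Bx gl.
have [cS nS tS Sy] := fS.
(* The default value [x] is the one taken at [y], which lies in no piece. *)
pose h z := if pselect (exists k, T k z) is left e then g (projT1 (cid e)) z
            else x.
have hT k z : T k z -> h z = g k z.
  move=> Tkz; rewrite /h; case: pselect => [e|[]]; last by exists k.
  case: cid => j /= Tjz; congr (g _ z).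
  by apply: tS => //; exists z; split; apply: TS.
have hy : h y = x.
  by rewrite /h; case: pselect => // e; have [k /TS /nS] := e.
exists h; split=> [|z [->|[k _ Tkz]]]; last 2 first.
- by rewrite hy.
- by rewrite (hT k)//; have [_ /(_ z Tkz)[fg [Vg _]]] := gl k.
apply/within_continuousP => z N [->|[k _ Tkz]].
  rewrite hy => xN; have [m _ mN] := Bx _ xN.
  have cl : closed (\bigcup_(i in `I_m) S i).
    by apply: closed_bigcup => [|i _]; [apply: finite_II | apply: cS].
  have : nbhs y (~` \bigcup_(i in `I_m) S i).
    by apply: open_nbhs_nbhs; split; [apply: closed_openC | move=> [i _ /nS]].
  apply: filterS => w nw /= [->|[k _ Tkw]]; first by rewrite hy; apply: nbhs_singleton.
  rewrite (hT k)//; have [_ /(_ w Tkw)[_ [_ Bk]]] := gl k.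
  apply: (mN k) => //=; rewrite leqNgt; apply/negP => km.
  by apply: nw; exists k => //; apply: TS.
rewrite (hT k)// => zN.
have [/within_continuousP gk _] := gl k.
pose C := y |` \bigcup_(i in ~` [set k]) S i.
have cC : closed C by apply: closed_fan.
have nCz : ~ C z.
  move=> [zy|[i /= ik Siz]]; first by apply: (nS k); rewrite -zy; apply: TS.
  by apply: ik; apply: (tS i k) => //; exists z; split=> //; apply: TS.
have zC : nbhs z (~` C) by apply: open_nbhs_nbhs; split=> //; apply: closed_openC.
have zgN := gk z N Tkz zN.
apply: filterS (filterI zC zgN) => w [nC gw] [wy|[i _ Tiw]]; first by case: nC; left.
have [ik|ik] := pselect (i = k); last by case: nC; right; exists i => //; apply: TS.
by move: Tiw; rewrite ik => Tkw; rewrite (hT k)//; apply: gw.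
Qed.

(** * Compacta with their associated sub-compacta *)

(** What the lifting argument uses of a compact [S] at [y] whose associated
sub-compacta are the sets satisfying [A]; the last field is what allows a
section to be confined to a neighborhood of its value at [y]. *)
Record compactum {Y : topologicalType} (y : Y) (S : set Y)
    (A : set Y -> Prop) : Prop := Compactum {
  compactum_closed : closed S;
  compactum_center : S y;
  compactum_sub : forall T, A T -> T `<=` S;
  compactum_sub_center : forall T, A T -> T y;
  compactum_shrink : forall T N, A T -> nbhs y N ->
    exists2 T', A T' & T' `<=` T `&` N }.

Lemma compactum_point {Y : topologicalType} (y : Y) :
  hausdorff_space Y -> compactum y [set y] (eq [set y]).
Proof.
move=> hY; split=> //.
- by apply: accessible_closed_set1; apply: hausdorff_accessible.
- by move=> T <-.
- by move=> T <-.
- move=> T N <- yN; exists [set y] => // _ ->; split=> //.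
  exact: nbhs_singleton.
Qed.

(** Dropping finitely many pieces of a sub-compact leaves a sub-compact; this
brings it into any neighborhood of [y] without changing the remaining pieces. *)
Lemma compactum_fan {Y : topologicalType} (y : Y) (D : nat -> Y)
    (S : nat -> set Y) (A : nat -> set Y -> Prop) :
  hausdorff_space Y -> fan y S -> (forall i, compactum (D i) (S i) (A i)) ->
  compactum y (y |` \bigcup_i S i) (subfan y A).
Proof.
move=> hY fS cA; split.
- exact: closed_fan.
- by left.
- move=> _ [n [T [nh AT ->]]] z [->|[k _ Tkz]]; [by left|right].
  by exists (n k) => //; apply: (compactum_sub (cA _) (AT k)) Tkz.
- by move=> _ [n [T [nh AT ->]]]; left.
- move=> _ N [n [T [nh AT ->]]] yN.
  have [_ _ _ /(_ _ yN)[m _ mN]] := fS.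
  exists (y |` \bigcup_k T (m + k)%N).
    exists (fun k => n (m + k)%N), (fun k => T (m + k)%N); split=> //.
    by move=> i j ij; apply: nh; rewrite ltn_add2l.
  move=> z [->|[k _ Tz]]; first by split; [left | apply: nbhs_singleton].
  split; first by right; exists (m + k)%N.
  apply: (mN (n (m + k))).
    exact: leq_trans (leq_addr k m) (leq_homo_ltn nh _).
  exact: (compactum_sub (cA _) (AT _)) Tz.
Qed.

(** Induction on canonical compacta in which the rank one, successor and limit
cases are the same: rank one is a fan whose pieces are points. *)
Lemma canonical_compact_fan_ind {R : realType} {Y : metricType R}
    (P : Y -> set Y -> (set Y -> Prop) -> Prop) :
  (forall y, P y [set y] (eq [set y])) ->
  (forall y D O S A, spread y D O -> (forall i, S i `<=` O i) ->
    (forall i, P (D i) (S i) (A i)) -> P y (y |` \bigcup_i S i) (subfan y A)) ->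
  forall a y S (c : canonical_compact a y S), P y S (associated c).
Proof.
move=> P0 PS a y S; elim=> {a y S} [a y D O _ sp|b a y D O S _ _ sp SO c IH|
    b a y D O S _ _ _ sp SO c IH] /=; last 2 first.
- exact: PS sp SO IH.
- exact: PS sp SO IH.
have := PS y D O (fun i => [set D i]) (fun i => eq [set D i]) sp.
rewrite bigcup_imset1.
have -> : subfan y (fun i => eq [set D i]) =
    fun T => exists2 n : nat -> nat, {homo n : i j / (i < j)%N} &
        T = y |` range (D \o n).
  apply/funext => T; apply/propext; split=> [[n [T' [nh DT ->]]]|[n nh ->]].
    exists n => //; congr (_ `|` _).
    rewrite -(bigcup_imset1 _ (D \o n)).
    by apply: eq_bigcup => // k _; rewrite -DT.
  exists n, (fun k => [set D (n k)]); split=> //.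
  by rewrite (bigcup_imset1 _ (D \o n)).
apply=> // i _ ->; have [_ /(_ i)[Di _ _]] := sp; exact: nbhs_singleton.
Qed.

(** * Lifting along a stable map *)

(** Stability with its witness made explicit: liftability refers to one [eta],
fixed throughout the induction. *)
Definition stable_by {X Y : topologicalType} (f : X -> Y)
    (eta : Y -> set (set X)) : Prop :=
  (forall y U, eta y U -> U `&` f @^-1` [set y] !=set0) /\
  (forall y U V, eta y U -> open V -> U `&` f @^-1` [set y] `<=` V ->
     \forall w \near y, eta w V).

Definition liftable {X Y : topologicalType} (f : X -> Y)
    (eta : Y -> set (set X)) (y : Y) (A : set Y -> Prop) : Prop :=
  forall V, open V -> eta y V -> exists2 T, A T & exists g, lift f T V g.

Lemma liftable_point {X Y : topologicalType} (f : X -> Y) eta (y : Y) :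
  stable_by f eta -> liftable f eta y (eq [set y]).
Proof.
move=> [eta_meets _] V oV /eta_meets[x [Vx fx]].
exists [set y] => //; exists (cst x); split; last by move=> _ ->.
by apply: continuous_subspaceT => z; apply: cvg_cst.
Qed.

(** Around [x] one finds sections over sub-compacta of arbitrarily late pieces.
If no [x] worked, the union [W] of the open sets without any such section would
contain [V `&` f @^-1` [set y]], so that stability and liftability of a late
piece produce a section into [W], hence into one of these open sets. *)
Lemma exists_good_point {X Y : topologicalType} (f : X -> Y) eta (y : Y)
    (D : nat -> Y) (S : nat -> set Y) (A : nat -> set Y -> Prop) (V : set X) :
  continuous f -> stable_by f eta ->
  fan y S -> (forall i, compactum (D i) (S i) (A i)) ->
  (forall i, liftable f eta (D i) (A i)) ->
  open V -> eta y V ->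
  exists x, [/\ V x, f x = y & forall B m, open_nbhs x B ->
    exists i T g, [/\ (m <= i)%N, A i T & lift f T B g]].
Proof.
move=> fc [eta_meets eta_open] fS cA lA oV etaV.
have [cS nS _ Sy] := fS.
apply: contrapT => nogood.
pose bad B := open B /\ forall i T g, A i T -> ~ lift f T B g.
pose W := \bigcup_(B in bad) B.
have oW : open W by apply: bigcup_open => B [].
have VW : V `&` f @^-1` [set y] `<=` W.
  move=> x [Vx fx]; apply: contrapT => nWx; apply: nogood.
  exists x; split=> // B m [oB Bx]; apply: contrapT => nB; apply: nWx.
  (* Removing the fibers over the first [m] pieces makes [B] bad for every
     index, since a section over a sub-compact of [S i] takes at [D i] a value
     above [S i]. *)
  pose F := \bigcup_(i in `I_m) S i.
  have cF : closed F.
    by apply: closed_bigcup => [|i _]; [apply: finite_II | apply: cS].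
  exists (B `&` f @^-1` (~` F)).
    split.
      by apply: openI => //; apply: open_comp; [move=> ? _; apply: fc | apply: closed_openC].
    move=> i T g AT [gc gl].
    have [im|mi] := ltnP i m.
      have Tz := compactum_sub_center (cA i) AT.
      have [fg [_ /=]] := gl _ Tz; rewrite fg; apply.
      by exists i => //; apply: compactum_center (cA i).
    apply: nB; exists i, T, g; split=> //; split=> // z /gl[? []] //.
  by split=> //=; rewrite fx => -[i _ /nS].
have [m _ mW] := Sy _ (eta_open _ _ _ etaV oW VW).
have /mW : (m <= m)%N by [].
move=> /(_ _ (compactum_center (cA m))) etaW.
have [T AT [g [gc gl]]] := lA m _ oW etaW.
have TD := compactum_sub_center (cA m) AT.
(* The section may meet many bad sets; near [D m] one of them is enough. *)
have [_ [B [oB nB] BD]] := gl _ TD.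
have NB := (within_continuousP _ _).1 gc _ _ TD (open_nbhs_nbhs (conj oB BD)).
have [T' AT' T'N] := compactum_shrink (cA m) AT NB.
apply: (nB m T' g AT'); split.
  by apply: continuous_subspaceW gc => z /T'N[].
by move=> z /T'N[Tz Bz]; split; [case: (gl _ Tz) | apply: Bz].
Qed.

Lemma increasing_choice {T : Type} (P : nat -> nat -> T -> Prop) :
  (forall k m, exists i t, (m <= i)%N /\ P k i t) ->
  exists (n : nat -> nat) (t : nat -> T),
    {homo n : i j / (i < j)%N} /\ forall k, P k (n k) (t k).
Proof.
move=> ext.
have [c cP] : {c : nat * nat -> nat * T |
    forall km, (km.2 <= (c km).1)%N /\ P km.1 (c km).1 (c km).2}.
  apply: cid; have [|c cP] := @choice (nat * nat)%type (nat * T)%type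
      (fun km it => (km.2 <= it.1)%N /\ P km.1 it.1 it.2); last by exists c.
  by move=> [k m]; have [i [t it]] := ext k m; exists (i, t).
pose n := fix n k := if k is k'.+1 then (c (k, (n k').+1)).1 else (c (0, 0)%N).1.
exists n, (fun k => (c (k, if k is k'.+1 then (n k').+1 else 0%N)).2); split.
  apply: homo_ltn => [? ? ?|k]; first exact: ltn_trans.
  exact: (cP (k.+1, (n k).+1)).1.
by case=> [|k]; [apply: (cP (0, 0)%N).2 | apply: (cP (k.+1, (n k).+1)).2].
Qed.

(** The sections to be glued are chosen, along a subsequence of the pieces, in
balls of radius tending to zero around a good point. *)
Lemma liftable_fan {R : realType} {X : metricType R} {Y : topologicalType}
    (f : X -> Y) eta (y : Y)
    (D : nat -> Y) (S : nat -> set Y) (A : nat -> set Y -> Prop) :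
  hausdorff_space Y -> continuous f -> stable_by f eta ->
  fan y S -> (forall i, compactum (D i) (S i) (A i)) ->
  (forall i, liftable f eta (D i) (A i)) ->
  liftable f eta y (subfan y A).
Proof.
move=> hY fc st fS cA lA V oV etaV.
have [x [Vx fx xgood]] :=
  exists_good_point fc st fS cA lA oV etaV.
pose B k := interior (ball x (k.+1%:R^-1 : R)).
have Bx N : nbhs x N -> \forall k \near \oo, B k `<=` N.
  move=> /nbhs_ballP[e /= e0 eN].
  have := near_infty_natSinv_lt (PosNum e0); apply: filterS => k /= ke.
  apply: subset_trans eN; apply: (subset_trans (@interior_subset _ _)).
  by apply: le_ball; apply: ltW.
have VB k : open_nbhs x (V `&` B k).
  split; first by apply: openI => //; apply: open_interior.
  split=> //; apply: nbhsx_ballx; rewrite invr_gt0 ltr0n //.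
have [|n [Tg [nh TgP]]] := @increasing_choice (set Y * (Y -> X))
    (fun k i p => A i p.1 /\ lift f p.1 (V `&` B k) p.2).
  by move=> k m; have [i [T [g [mi AT gl]]]] := xgood _ m (VB k); exists i, (T, g).
exists (y |` \bigcup_k (Tg k).1).
  by exists n, (fun k => (Tg k).1); split=> // k; case: (TgP k).
apply: (@lift_glue _ _ f y (S \o n) _ V B x (fun k => (Tg k).2)) => //.
- exact: fan_comp.
- by move=> k; apply: (compactum_sub (cA _)); case: (TgP k).
- by move=> k; case: (TgP k).
Qed.

Lemma lift_homeo {X Y : topologicalType} (f : X -> Y) T V g :
  continuous f -> lift f T V g -> restricts_to_homeo f (g @` T) T.
Proof.
move=> fc [gc gl]; split.
- split=> [_ [z Tz <-]|_ _ /set_mem[z Tz <-] /set_mem[w Tw <-]|z Tz] /=.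
  + by rewrite (gl z Tz).1.
  + by rewrite (gl z Tz).1 (gl w Tw).1 => ->.
  + by exists (g z); [exists z | rewrite (gl z Tz).1].
- exact: continuous_subspaceT.
- exists g; split=> // _ /set_mem[z Tz <-]; by rewrite (gl z Tz).1.
Qed.

Theorem theorem4p1 (R : realType) (X Y : metricType R) (f : X -> Y)
  (Y_no_isolated : isolated [set: Y] = set0)
  (f_continuous : continuous f)
  (f_surj : set_surj [set: X] [set: Y] f) :
  stable f -> H_covering f.
Proof.
move=> [eta [eta0 eta_meets eta_open]] a _ y S c.
have hY : hausdorff_space Y by exact: metric_hausdorff.
have st : stable_by f eta by [].
have [_ lc] : compactum y S (associated c) /\ liftable f eta y (associated c).
  pose P y S A := @compactum Y y S A /\ liftable f eta y A.
  apply: (@canonical_compact_fan_ind R Y P) => {a y S c} [y|y D O S A sp SO PA].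
    by split; [apply: compactum_point | apply: liftable_point].
  have cA i := (PA i).1; have lA i := (PA i).2.
  have fS : fan y S.
    by apply: spread_fan sp SO _ => i; apply: compactum_closed (cA i).
  split; first exact: compactum_fan cA.
  exact: liftable_fan cA lA.
have [U etaU] := eta0 y.
have etaT : eta y setT.
  by apply: nbhs_singleton (eta_open y U setT etaU openT _).
have [T AT [g gl]] := lc _ openT etaT.
exists T => //; exists (g @` T); exact: lift_homeo gl.
Qed.
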